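(* Let $K=\mathbb{F}_q$ be a finite field with $q\neq 2$, and let $\mathcal{C}$ be a clutter with $s$ edges. Let $X$, $Y$, $I(X)\subset S=K[t_1,\ldots,t_s]$ and $I(Y)\subset S[u]$, $u=t_{s+1}$, be as defined in the context, and let $F_X(t)$ and $F_Y(t)$ be the Hilbert series of $S/I(X)$ and $S[u]/I(Y)$ respectively. If $I(Y)=I(X)+(t_1^{q-1}-t_{s+1}^{q-1})$ (where $I(X)$ on the right denotes $I(X)S[u]$), then (a) $F_Y(t)=F_X(t)(1+t+\cdots+t^{q-2})$, (b) $|Y|=(q-1)|X|$, (c) ${\rm reg}(S[u]/I(Y))=(q-2)+{\rm reg}(S/I(X))$.
   Context: A clutter $\mathcal{C}$ is a family of subsets (edges) of a finite vertex set $\{y_1,\ldots,y_n\}$ such that no edge is contained in a different edge. Let $f_1,\ldots,f_s$ ($s\geq 1$) be the edges of $\mathcal{C}$ and let $v_i=\sum_{y_j\in f_i}e_j\in\{0,1\}^n$ be the characteristic vector of $f_i$. Put $K^*=K\setminus\{0\}$ and, for $x\in (K^* )^n$, $x^{v_i}=x_1^{v_{i1}}\cdots x_n^{v_{in}}$. Define $X=\{[(x^{v_1},\ldots,x^{v_s})] : x\in (K^* )^n\}\subset\mathbb{P}^{s-1}$ and $Y=\{[(x^{v_1},\ldots,x^{v_s},1)] : x\in (K^* )^n\}\subset\mathbb{P}^{s}$, projective spaces over $K$. The rings $S=K[t_1,\ldots,t_s]$ and $S[u]$, $u=t_{s+1}$, are polynomial rings with the standard grading. $I(X)$ (resp. $I(Y)$)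 is the ideal of $S$ (resp. $S[u]$) generated by the homogeneous polynomials that vanish on $X$ (resp. $Y$). The Hilbert function of $S/I(X)$ is $H_X(d)=\dim_K (S/I(X))_d$, and its Hilbert series is $F_X(t)=\sum_{d\geq 0}H_X(d)t^d$; similarly $H_Y$, $F_Y$ for $S[u]/I(Y)$. $H_X(d)$ is constant, equal to $|X|$, for $d\gg 0$, and ${\rm reg}(S/I(X))$ is the least integer $p\geq 0$ such that $H_X(d)=|X|$ for all $d\geq p$ (this equals the Castelnuovo-Mumford regularity); ${\rm reg}(S[u]/I(Y))$ is defined likewise with $H_Y$ and $|Y|$. *)

(* Defs.v *)
From HB Require Import structures.
From mathcomp Require Export all_boot all_order all_algebra.
From mathcomp Require Export boolp classical_sets.
From mathcomp Require Export mpoly.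

Set Implicit Arguments.
Unset Strict Implicit.
Unset Printing Implicit Defensive.

Import GRing.Theory.
Local Open Scope ring_scope.

Definition is_clutter (V : finType) (C : {set {set V}}) : Prop :=
  forall e e' : {set V}, e \in C -> e' \in C -> e \subset e' -> e = e'.

Definition char_vec n (e : {set 'I_n}) : 'rV[nat]_n := \row_j (j \in e : nat).

Section ProjectiveSpace.
Variable K : finFieldType.

Definition line m (v : 'rV[K]_m) : {set 'rV[K]_m} :=
  [set w | [exists c : K, (c != 0) && (w == c *: v)]].

(* P(K^m), of dimension m - 1: a point is the set of all its homogeneous
   coordinate vectors, that is, a punctured line through the origin. *)
Definition proj_space m : predArgType :=
  {L : {set 'rV[K]_m} | [exists v, (v != 0) && (L == line v)]}.

Definition rV_power n (x : 'rV[K]_n) (a : 'rV[nat]_n) : K :=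
  \prod_(j < n) x 0 j ^+ a 0 j.

Definition in_torus n (x : 'rV[K]_n) : bool := [forall j, x 0 j != 0].

Definition param_X n s (f : 'I_s -> {set 'I_n}) (x : 'rV[K]_n) : 'rV[K]_s :=
  \row_i rV_power x (char_vec (f i)).

(* ord_max indexes the additional coordinate, matching the variable that mwiden
   adjoins. *)
Definition param_Y n s (f : 'I_s -> {set 'I_n}) (x : 'rV[K]_n) : 'rV[K]_s.+1 :=
  \row_k if unlift ord_max k is Some i then rV_power x (char_vec (f i)) else 1.

Definition toric_X n s (f : 'I_s -> {set 'I_n}) : {set proj_space s} :=
  [set P | [exists x, in_torus x && (val P == line (param_X f x))]].

Definition toric_Y n s (f : 'I_s -> {set 'I_n}) : {set proj_space s.+1} :=
  [set P | [exists x, in_torus x && (val P == line (param_Y f x))]].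

End ProjectiveSpace.

Section Ideals.
Variable R : comNzRingType.

Definition ideal_gen (G : R -> Prop) (p : R) : Prop :=
  exists k (a g : 'I_k -> R),
    (forall i, G (g i)) /\ p = \sum_(i < k) a i * g i.

Definition ideal_add (I J : R -> Prop) (p : R) : Prop :=
  exists a b, [/\ I a, J b & p = a + b].

End Ideals.

(* Extension of an ideal of S to S[u], where u is the variable 'X_ord_max. *)
Definition ideal_widen (R : comNzRingType) s (I : {mpoly R[s]} -> Prop) :
    {mpoly R[s.+1]} -> Prop :=
  ideal_gen (fun p => exists2 g, I g & p = mwiden g).

Section VanishingIdeal.
Variables (K : finFieldType) (m : nat).

Definition vanishes_on (Z : {set proj_space K m}) (p : {mpoly K[m]}) : Prop :=
  forall P : proj_space K m, P \in Z -> forall v, v \in val P -> p.@[v 0] = 0.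

Definition vanishing_ideal (Z : {set proj_space K m}) : {mpoly K[m]} -> Prop :=
  ideal_gen (fun p => p \is homog mdeg /\ vanishes_on Z p).

End VanishingIdeal.

(* The classes of the b_i form a basis of the image of A in V / W. *)
Definition quot_basis (F : fieldType) (V : lmodType F) (A W : V -> Prop)
    k (b : 'I_k -> V) : Prop :=
  (forall i, A (b i)) /\
  (forall p, A p -> exists! c : 'rV[F]_k, W (p - \sum_(i < k) c 0 i *: b i)).

(* The value is 0 when the image of A in V / W is infinite-dimensional. *)
Definition quot_dim (F : fieldType) (V : lmodType F) (A W : V -> Prop) : nat :=
  xget 0%N [set k | exists b : 'I_k -> V, quot_basis A W b].

Section Hilbert.
Variables (K : fieldType) (m : nat).

Definition hilbert_fun (I : {mpoly K[m]} -> Prop) (d : nat) : nat :=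
  quot_dim (fun p : {mpoly K[m]} => p \is d.-homog) I.

Definition is_reg_index (I : {mpoly K[m]} -> Prop) (N p : nat) : Prop :=
  forall d, (p <= d)%N -> hilbert_fun I d = N.

(* The least p such that the Hilbert function is equal to N from p on; the
   value is 0 when there is no such p. *)
Definition regularity (I : {mpoly K[m]} -> Prop) (N : nat) : nat :=
  xget 0%N [set p | is_reg_index I N p /\
                    forall p', is_reg_index I N p' -> (p <= p')%N].

End Hilbert.

(* Formal power series over the integers, as coefficient sequences. *)
Definition fps : Type := nat -> int.

Definition fps_mul (F G : fps) : fps :=
  fun d => \sum_(i < d.+1) F i * G (d - i)%N.

Definition fps_of_poly (p : {poly int}) : fps := fun d => p`_d.

Definition hilbert_series (K : fieldType) m (I : {mpoly K[m]} -> Prop) : fps :=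
  fun d => (hilbert_fun I d)%:Z.

(* Main.v *)
(* Write q = #|K|. A homogeneous form lies in I(X) iff it vanishes on X, so
   H_X(d) is the rank of evaluation of degree d forms at the points of X;
   it is at most |X|, with equality for d >= |X| since products of linear forms
   separate points.

   On Y one has u ^ (q-1) = t_1 ^ (q-1), so each degree d form of S[u] reduces
   modulo I(Y) to a form sum_(i <= q-2) g_i u^i with g_i in S_(d-i). The
   hypothesis on I(Y) gives uniqueness: a form in I(Y) vanishes at (v, a) for all
   v representing a point of X and all a != 0, because v_1 ^ (q-1) = 1 =
   a ^ (q-1). A polynomial in a of degree < q-1 with q-1 nonzero roots is 0, so
   if the reduced form lies in I(Y) then every g_i vanishes on X. Hence
   H_Y(d) = sum_(i <= min(q-2, d)) H_X(d-i), which is (a); (b) follows by taking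
   d large, and (c) because H_X never exceeds |X| > 0. *)

From HB Require Import structures.
Require Import Defs.
From mathcomp Require Import all_boot all_order all_algebra.
From mathcomp Require Import boolp classical_sets mpoly.
From mathcomp Require Import finfield zify.

Set Implicit Arguments.
Unset Strict Implicit.
Unset Printing Implicit Defensive.

Import GRing.Theory.
Local Open Scope ring_scope.

(** * Dimension of [A] modulo [W] when [W] is, on [A], the kernel of a linear map *)

Section QuotientDimension.
Variables (F : fieldType) (V : lmodType F) (N : nat).
Variables (A W : V -> Prop) (phi : {linear V -> 'rV[F]_N}).
Hypothesis A_closed : forall c p q, A p -> A q -> A (c *: p + q).
Hypothesis A0 : A 0.
Hypothesis W_ker : forall p, A p -> W p <-> phi p = 0.

Definition image_mx k (b : 'I_k -> V) : 'M[F]_(k, N) := \matrix_i phi (b i).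

Lemma closed_sum (I : Type) (r : seq I) (P : pred I) (c : I -> F) (b : I -> V) :
  (forall i, A (b i)) -> A (\sum_(i <- r | P i) c i *: b i).
Proof.
move=> Ab; elim/big_rec: _ => [|i v _ Av]; first exact: A0.
exact: A_closed.
Qed.

Lemma closed_sub p q : A p -> A q -> A (p - q).
Proof. by move=> Ap Aq; rewrite addrC -scaleN1r; apply: A_closed. Qed.

Lemma image_lincomb k (b : 'I_k -> V) (c : 'rV[F]_k) :
  phi (\sum_i c 0 i *: b i) = c *m image_mx b.
Proof.
rewrite linear_sum mulmx_sum_row; apply: eq_bigr => i _.
by rewrite linearZ rowK.
Qed.

Lemma ker_lincomb k (b : 'I_k -> V) p (c : 'rV[F]_k) :
  (forall i, A (b i)) -> A p ->
  W (p - \sum_i c 0 i *: b i) <-> phi p = c *m image_mx b.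
Proof.
move=> Ab Ap; rewrite W_ker; last by apply/closed_sub/closed_sum.
rewrite linearB image_lincomb; split=> [/eqP|->]; last exact: subrr.
by rewrite subr_eq0 => /eqP.
Qed.

(** Classes modulo [W] are detected by [phi], so coordinates modulo [W] are coordinates with respect
    to the rows of [image_mx b]: their uniqueness is row freeness, their existence is spanning. *)
Lemma quot_basisP k (b : 'I_k -> V) : (forall i, A (b i)) ->
  quot_basis A W b <->
    row_free (image_mx b) /\ forall p, A p -> (phi p <= image_mx b)%MS.
Proof.
move=> Ab; split=> [[_ bP]|[bfree bspan]]; split=> //.
(* Each row of the left kernel gives coordinates of [0], and so does the zero row; uniqueness
   identifies them. *)
- rewrite -kermx_eq0; apply/eqP/row_matrixP => i; rewrite row0.
  have [c [_ cU]] := bP 0 A0.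
  rewrite -(cU 0); last by rewrite ker_lincomb // mul0mx linear0.
  by apply/esym/cU; rewrite ker_lincomb // linear0 -row_mul mulmx_ker row0.
- move=> p Ap; have [c [/(ker_lincomb c Ab Ap)-> _]] := bP p Ap.
  exact: submxMl.
- move=> p Ap; have /submxP[c defc] := bspan p Ap; exists c.
  split=> [|c']; rewrite ker_lincomb // defc //.
  exact: row_free_inj.
Qed.

Lemma quot_dim_basis k (b : 'I_k -> V) : quot_basis A W b -> quot_dim A W = k.
Proof.
move=> bB; apply: xget_unique => [|k' [b' b'B]]; first by exists b.
have [[bA _] [b'A _]] := (bB, b'B).
have [/eqP bk bS] := (quot_basisP bA).1 bB.
have [/eqP b'k b'S] := (quot_basisP b'A).1 b'B.
rewrite -bk -b'k; apply/eqP; rewrite eqn_leq; apply/andP.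
by split; apply/mxrankS/row_subP => i; rewrite rowK; [apply: bS | apply: b'S].
Qed.

(** A family in [A] with independent images has at most [N] members. One of maximal size spans,
    since a [p] with image outside the span could be adjoined. *)
Lemma quot_basis_exists : exists k (b : 'I_k -> V), quot_basis A W b.
Proof.
pose P k := `[< exists2 b : 'I_k -> V, forall i, A (b i)
                & row_free (image_mx b) >].
have P0 : exists k, P k.
  exists 0%N; apply/asboolP; exists (fun=> 0) => //.
  by rewrite /row_free eqn_leq rank_leq_row.
have PN k : P k -> (k <= N)%N.
  by move=> /asboolP[b _ /eqP <-]; exact: rank_leq_col.
case: (ex_maxnP P0 PN) => k /asboolP[b Ab bfree] kmax.
exists k, b; apply/quot_basisP => //; split=> // p Ap.
apply: contraT => pNb.
have /kmax : P k.+1; last by rewrite ltnn.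
apply/asboolP; exists (fun i => if unlift ord0 i is Some j then b j else p).
  by move=> i; case: unliftP.
apply: inj_row_free => v; rewrite -image_lincomb big_ord_recl unlift_none.
under eq_bigr do rewrite liftK.
set w := \row_i v 0 (lift ord0 i).
have -> : \sum_i v 0 (lift ord0 i) *: b i = \sum_i w 0 i *: b i.
  by apply: eq_bigr => i _; rewrite mxE.
rewrite linearD linearZ image_lincomb /= => eq0.
(* A nonzero coefficient of [p] could be inverted, putting [phi p] in the span of the other
   images. *)
have v0 : v 0 ord0 = 0.
  apply: contraNeq pNb => v0; apply/submxP; exists (- (v 0 ord0)^-1 *: w).
  move/eqP: eq0; rewrite addr_eq0 => /eqP eq0.
  by rewrite -scalemxAl scaleNr -scalerN -eq0 scalerA mulVf // scale1r.
move: eq0; rewrite v0 scale0r add0r => w0.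
have {}w0 : w = 0 by apply: (row_free_inj bfree); rewrite w0 mul0mx.
apply/rowP => i; rewrite !mxE; have [j ->|->//] := unliftP ord0 i.
by have /rowP/(_ j) := w0; rewrite !mxE.
Qed.

Lemma quot_dim_le : (quot_dim A W <= N)%N.
Proof.
have [k [b bB]] := quot_basis_exists; rewrite (quot_dim_basis bB).
by have [/eqP/esym bk _] := (quot_basisP bB.1).1 bB;
  rewrite [X in (X <= N)%N]bk rank_leq_col.
Qed.

Lemma quot_dim_surj : (forall v, exists2 p, A p & phi p = v) ->
  quot_dim A W = N.
Proof.
move=> phi_surj; have [k [b bB]] := quot_basis_exists.
have [/eqP bk bS] := (quot_basisP bB.1).1 bB.
rewrite (quot_dim_basis bB) -[LHS]bk; apply/eqP.
rewrite -[_ == _]/(row_full _) -sub1mx.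
by apply/row_subP => i; have [p Ap <-] := phi_surj (row i 1%:M); apply: bS.
Qed.

(** Form of the basis criterion suited to a family indexed by dependent pairs; uniqueness of
    coordinates is replaced by independence. *)
Lemma quot_dim_finType (I : finType) (b : I -> V) :
    (forall i, A (b i)) ->
    (forall p, A p -> exists c : I -> F, W (p - \sum_i c i *: b i)) ->
    (forall c : I -> F, W (\sum_i c i *: b i) -> forall i, c i = 0) ->
  quot_dim A W = #|I|.
Proof.
move=> Ab bspan bfree; pose b' (i : 'I_#|I|) := b (enum_val i).
have Ab' i : A (b' i) by exact: Ab.
have sumE (c : I -> F) : \sum_i c i *: b i =
    \sum_(i < #|I|) (\row_i c (enum_val i)) 0 i *: b' i.
  rewrite (reindex (@enum_val I predT)); last exact/onW_bij/enum_val_bij.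
  by apply: eq_bigr => i _; rewrite mxE.
apply: (quot_dim_basis (b := b')); apply/quot_basisP => //; split.
  apply: inj_row_free => c; rewrite -image_lincomb => c0.
  have /bfree c'0 : W (\sum_i c 0 (enum_rank i) *: b i).
    rewrite W_ker; last exact: closed_sum.
    rewrite sumE; set c' := \row_i _; suff -> : c' = c by [].
    by apply/rowP => i; rewrite mxE enum_valK.
  by apply/rowP => i; rewrite mxE -(enum_valK i) c'0.
move=> p Ap; have [c] := bspan p Ap.
by rewrite sumE ker_lincomb // => ->; apply: submxMl.
Qed.

End QuotientDimension.

(** * Hilbert functions of finite sets of projective points, through evaluation *)

Section VanishingIdealHilbert.
Variables (K : finFieldType) (m : nat).
Implicit Types (Z : {set proj_space K m}) (p : {mpoly K[m]}) (v w : 'rV[K]_m).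

Lemma lineP v w : reflect (exists2 c : K, c != 0 & w = c *: v) (w \in line v).
Proof.
rewrite inE; apply: (iffP existsP) => [[c /andP[c0 /eqP->]]|[c c0 ->]].
  by exists c.
by exists c; rewrite c0 eqxx.
Qed.

Lemma line_id v : v \in line v.
Proof. by apply/lineP; exists 1; rewrite ?oner_eq0 ?scale1r. Qed.

Lemma line_scale (c : K) v : c != 0 -> line (c *: v) = line v.
Proof.
move=> c0; apply/setP => w; apply/lineP/lineP => -[a a0 ->].
  by exists (a * c); rewrite ?mulf_neq0 ?scalerA.
by exists (a / c); rewrite ?mulf_neq0 ?invr_eq0 // scalerA divfK.
Qed.

Definition proj_repr (P : proj_space K m) : 'rV[K]_m :=
  xchoose (existsP (valP P)).

Lemma proj_repr_neq0 P : proj_repr P != 0.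
Proof. by case/andP: (xchooseP (existsP (valP P))). Qed.

Lemma val_proj P : val P = line (proj_repr P).
Proof. by apply/eqP; case/andP: (xchooseP (existsP (valP P))). Qed.

Lemma proj_repr_mem P : proj_repr P \in val P.
Proof. by rewrite val_proj line_id. Qed.

Lemma proj_line v : v != 0 -> exists P : proj_space K m, val P = line v.
Proof.
move=> v0; have Pv : [exists w, (w != 0) && (line v == line w)].
  by apply/existsP; exists v; rewrite v0 eqxx.
pose isP (L : {set 'rV[K]_m}) := is_true [exists w, (w != 0) && (L == line w)].
by exists (exist isP (line v) Pv).
Qed.

Lemma meval_scale d p (c : K) v :
  p \is d.-homog -> p.@[(c *: v) 0] = c ^+ d * p.@[v 0].
Proof.
move=> /dhomogP p_hom; rewrite !mevalE mulr_sumr !big_seq.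
apply: eq_bigr => u /p_hom mdegu; rewrite mulrCA; congr (_ * _).
under eq_bigr do rewrite mxE exprMn.
by rewrite big_split prodrXr -mdegE mdegu.
Qed.

(** The values depend on the chosen representatives, but for a form a change of representative only
    multiplies an entry by a nonzero scalar, so the kernel in each degree does not. *)
Definition eval_mx Z p : 'rV[K]_#|Z| :=
  \row_i p.@[proj_repr (enum_val i) 0].

Lemma eval_mx_is_linear Z : linear (eval_mx Z).
Proof. by move=> c p q; apply/rowP => i; rewrite !mxE mevalD mevalZ. Qed.

HB.instance Definition _ Z :=
  GRing.isLinear.Build K {mpoly K[m]} 'rV[K]_#|Z| _ (eval_mx Z)
    (eval_mx_is_linear Z).

Lemma vanishes_onP Z d p :
  p \is d.-homog -> vanishes_on Z p <-> eval_mx Z p = 0.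
Proof.
move=> p_hom; split=> [pZ|p0 P PZ v].
  apply/rowP => i; rewrite !mxE.
  exact: (pZ (enum_val i) (enum_valP i) _ (proj_repr_mem _)).
rewrite val_proj => /lineP[c _ ->]; rewrite (meval_scale _ _ p_hom).
have /rowP/(_ (enum_rank_in PZ P)) := p0.
by rewrite !mxE enum_rankK_in // => ->; rewrite mulr0.
Qed.

Lemma vanishing_ideal_vanishes Z p : vanishing_ideal Z p -> vanishes_on Z p.
Proof.
case=> k [a [g [gZ ->]]] P PZ v vP; rewrite (big_morph _ (mevalD _) (meval0 _)).
by apply: big1 => i _; rewrite mevalM (proj2 (gZ i) P PZ v vP) mulr0.
Qed.

Lemma vanishing_idealP Z d p :
  p \is d.-homog -> vanishing_ideal Z p <-> vanishes_on Z p.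
Proof.
move=> p_hom; split=> [|pZ]; first exact: vanishing_ideal_vanishes.
exists 1%N, (fun=> 1), (fun=> p); rewrite big_ord1 mul1r; split=> // _.
by split=> //; apply/homogP; exists d.
Qed.

Lemma vanishing_ideal_ker Z d p :
  p \is d.-homog -> vanishing_ideal Z p <-> eval_mx Z p = 0.
Proof.
by move=> p_hom; rewrite (vanishing_idealP _ p_hom) (vanishes_onP _ p_hom).
Qed.

Lemma dhomog_closed d (c : K) p q :
  p \is d.-homog -> q \is d.-homog -> c *: p + q \is d.-homog.
Proof. by move=> p_hom q_hom; rewrite rpredD ?rpredZ. Qed.

Lemma hilbert_fun_le Z d : (hilbert_fun (vanishing_ideal Z) d <= #|Z|)%N.
Proof.
exact: quot_dim_le (@dhomog_closed d) (rpred0 _) (@vanishing_ideal_ker Z d).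
Qed.

Lemma hilbert_basis_exists Z d : exists k (b : 'I_k -> {mpoly K[m]}),
  quot_basis (fun p => p \is d.-homog) (vanishing_ideal Z) b.
Proof.
exact: quot_basis_exists (@dhomog_closed d) (rpred0 _)
  (@vanishing_ideal_ker Z d).
Qed.

Lemma hilbert_fun_basis Z d k (b : 'I_k -> {mpoly K[m]}) :
  quot_basis (fun p => p \is d.-homog) (vanishing_ideal Z) b ->
  hilbert_fun (vanishing_ideal Z) d = k.
Proof.
move=> bB.
exact: (quot_dim_basis (@dhomog_closed d) (rpred0 _)
  (@vanishing_ideal_ker Z d) bB).
Qed.

Lemma dhomogXU i : 'X_i \is [in K[m], 1.-homog].
Proof. by rewrite dhomogX /= mdeg1. Qed.

(** Fix [j] with [w_j] nonzero. If every minor [w_j v_i - w_i v_j] vanished, [v] and [w] would be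
    proportional; a nonzero minor is the value at [v] of a linear form that kills [w]. *)
Lemma linear_form_sep (P Q : proj_space K m) : P != Q ->
  exists l : {mpoly K[m]}, [/\ l \is 1.-homog, l.@[proj_repr Q 0] = 0
    & l.@[proj_repr P 0] != 0].
Proof.
move=> PQ; set v := proj_repr P; set w := proj_repr Q.
have /rV0Pn[j wj] : w != 0 by apply: proj_repr_neq0.
have [i vi|] := pickP (fun i => w 0 j * v 0 i != w 0 i * v 0 j).
  exists (w 0 j *: 'X_i - w 0 i *: 'X_j); split.
  - by rewrite rpredB ?rpredZ ?dhomogXU.
  - by rewrite mevalB !mevalZ !mevalXU mulrC subrr.
  - by rewrite mevalB !mevalZ !mevalXU subr_eq0.
move=> all_eq; case/eqP: PQ; apply: val_inj.
have vw : v = (v 0 j / w 0 j) *: w.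
  apply/rowP => i; rewrite mxE; apply: (mulfI wj).
  have /negbFE/eqP -> := all_eq i.
  by rewrite mulrCA mulrA divfK // mulrC.
rewrite !val_proj -/v -/w {1}vw line_scale //.
by apply: contraNneq (proj_repr_neq0 P) => c0; rewrite -/v vw c0 scale0r.
Qed.

(** A product of linear forms, one for each point of [Z], each nonzero at [P] and zero at its own
    point if that differs from [P]. A power of a coordinate nonzero at [P] raises the degree to
    [d]. *)
Lemma separating_form Z P d : (#|Z| <= d)%N ->
  exists2 p : {mpoly K[m]}, p \is d.-homog &
    p.@[proj_repr P 0] = 1 /\
    forall Q, Q \in Z -> Q != P -> p.@[proj_repr Q 0] = 0.
Proof.
have /rV0Pn[j vj] := proj_repr_neq0 P; set v := proj_repr P in vj *.
pose sep Q (l : {mpoly K[m]}) := [/\ l \is 1.-homog, l.@[v 0] != 0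
  & Q != P -> l.@[proj_repr Q 0] = 0].
have /choice[l lP] (Q : proj_space K m) : exists l, sep Q l.
  have [->|QP] := eqVneq Q P.
    by exists 'X_j; split; rewrite ?eqxx ?dhomogXU ?mevalXU.
  rewrite eq_sym in QP; have [l [l1 lQ lv]] := linear_form_sep QP.
  by exists l; split.
move=> Zd; pose p := 'X_j ^+ (d - #|Z|) * \prod_(Q in Z) l Q.
have p_hom : p \is d.-homog.
  rewrite -(subnK Zd) /p; apply: dhomogM.
    rewrite -{2}[(d - _)%N]mul1n; exact/dhomogMn/dhomogXU.
  rewrite -sum1_card; elim/big_rec2: _ => [|Q e r _ r_hom]; first exact: dhomog1.
  by apply: dhomogM => //; case: (lP Q).
have pv : p.@[v 0] != 0.
  rewrite mevalM rmorphXn /= mevalXU mulf_neq0 ?expf_neq0 //.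
  rewrite rmorph_prod prodf_seq_neq0; apply/allP => Q _; apply/implyP => _.
  by case: (lP Q).
exists ((p.@[v 0])^-1 *: p); first by rewrite rpredZ.
split=> [|Q QZ QP]; first by rewrite mevalZ mulVf.
have [_ _ lQ0] := lP Q.
(* The normalising constant itself contains a value of [p]; generalising it confines the next
   rewrites to the value at [Q]. *)
rewrite mevalZ; move: (_^-1) => c.
by rewrite mevalM rmorph_prod (bigD1 Q) //= lQ0 // !(mul0r, mulr0).
Qed.

(** Separating forms are sent to the standard basis vectors, so evaluation is onto. *)
Lemma hilbert_fun_large Z d : (#|Z| <= d)%N ->
  hilbert_fun (vanishing_ideal Z) d = #|Z|.
Proof.
move=> Zd; apply: (quot_dim_surj (phi := eval_mx Z)) => [c p q||p|v].
- exact: dhomog_closed.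
- exact: rpred0.
- exact: vanishing_ideal_ker.
have /choice[g gP] (i : 'I_#|Z|) : exists q : {mpoly K[m]},
    q \is d.-homog /\ eval_mx Z q = delta_mx 0 i.
  have [p p_hom [pi pj]] := separating_form (enum_val i) Zd.
  exists p; split=> //; apply/rowP => j; rewrite !mxE eqxx /=.
  have [->|ji] := eqVneq; first exact: pi.
  by apply: pj; rewrite ?enum_valP // (inj_eq enum_val_inj).
exists (\sum_i v 0 i *: g i).
  by rewrite rpred_sum // => i _; rewrite rpredZ //; case: (gP i).
rewrite linear_sum [RHS]row_sum_delta; apply: eq_bigr => i _.
by rewrite linearZ /= (proj2 (gP i)).
Qed.
End VanishingIdealHilbert.

(** * Polynomials of [S] inside [S[u]], and splitting off the power of [u] *)

Section Widening.
Variables (R : comNzRingType) (m : nat).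
Implicit Types (p : {mpoly R[m]}) (u : 'X_{1..m}).

Lemma widen_ordSn_lift (i : 'I_m) : widen_ord (leqnSn m) i = lift ord_max i.
Proof. exact/val_inj/esym/lift_max. Qed.

Lemma meval_mwiden p (w : 'I_m.+1 -> R) :
  (mwiden p).@[w] = p.@[fun i => w (lift ord_max i)].
Proof.
elim/mpolyind: p => [|c x p _ _ IHp]; first by rewrite mwiden0 !meval0.
rewrite mwidenD mwidenZ mwidenX !mevalD !mevalZ !mevalX IHp big_ord_recr /=.
rewrite mnmwiden_ordmax expr0 mulr1; congr (_ * _ + _); apply: eq_bigr => i _.
by rewrite mnmwiden_widen widen_ordSn_lift.
Qed.

Lemma mwiden_dhomog d p : p \is d.-homog -> mwiden p \is d.-homog.
Proof.
move=> /dhomogP p_hom; rewrite [p]mpolyE big_seq.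
rewrite (big_morph _ (@mwidenD m R) (@mwiden0 m R)).
apply: rpred_sum => u /p_hom mdegu; rewrite mwidenZ mwidenX rpredZ //.
rewrite dhomogX -mdegu /= !mdegE big_ord_recr /= mnmwiden_ordmax addn0.
by apply/eqP/eq_bigr => i _; rewrite mnmwiden_widen.
Qed.

Definition mnmrestrict (u : 'X_{1..m.+1}) : 'X_{1..m} :=
  [multinom u (lift ord_max i) | i < m].

Lemma mdeg_mnmrestrict (u : 'X_{1..m.+1}) :
  mdeg u = (mdeg (mnmrestrict u) + u ord_max)%N.
Proof.
rewrite !mdegE big_ord_recr /=; congr (_ + _)%N; apply: eq_bigr => i _.
by rewrite mnmE widen_ordSn_lift.
Qed.

Lemma mpolyX_mnmrestrict (u : 'X_{1..m.+1}) :
  'X_[u] = mwiden 'X_[mnmrestrict u] * 'X_ord_max ^+ u ord_max :> {mpoly R[m.+1]}.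
Proof.
rewrite mwidenX mpolyXn -mpolyXD; congr 'X_[_]; apply/mnmP => i.
rewrite mnmDE mulmnE mnm1E; have [j ->|->] := unliftP ord_max i.
  by rewrite -widen_ordSn_lift mnmwiden_widen mnmE widen_ordSn_lift
    (negPf (neq_lift _ _)) addn0.
by rewrite mnmwiden_ordmax eqxx mul1n.
Qed.

End Widening.

(** * Reduction modulo [u^k = t_j^k] and the resulting formula for the Hilbert function *)

Section ConeHilbert.
Variables (K : finFieldType) (m : nat).
Variables (Z : {set proj_space K m}) (Z' : {set proj_space K m.+1}) (j : 'I_m).
Local Notation k := (#|K| - 1)%N.
Local Notation u := ('X_ord_max : {mpoly K[m.+1]}).

Definition append (v : 'rV[K]_m) (a : K) : 'rV[K]_m.+1 :=
  \row_l if unlift ord_max l is Some i then v 0 i else a.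

Lemma append_lift v a i : append v a 0 (lift ord_max i) = v 0 i.
Proof. by rewrite mxE liftK. Qed.

Lemma append_max v a : append v a 0 ord_max = a.
Proof. by rewrite mxE unlift_none. Qed.

Lemma meval_mwiden_append p v a : (mwiden p).@[append v a 0] = p.@[v 0].
Proof. by rewrite meval_mwiden; apply: meval_eq => i; rewrite append_lift. Qed.

(** An abstract form of the relation between X and Y. The first two assumptions let every form be
    reduced to powers of [u] below [k]; the third makes the reduced form unique modulo the ideal of
    [Z]. *)
Hypothesis vanish_mwiden : forall g, vanishes_on Z g -> vanishes_on Z' (mwiden g).
Hypothesis vanish_pow : vanishes_on Z' (mwiden 'X_j ^+ k - u ^+ k).
Hypothesis vanish_append : forall d p, p \is d.-homog -> vanishes_on Z' p ->
  forall P, P \in Z -> forall v, v \in val P -> forall a, a != 0 ->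
  p.@[append v a 0] = 0.

(** The entries of [w] are the coefficients of a polynomial of degree less than [q - 1] that has all
    [q - 1] nonzero elements of [K] as roots. *)
Lemma nonzero_roots_eq0 r (w : 'rV[K]_r) : (r <= k)%N ->
  (forall a, a != 0 -> \sum_i w 0 i * a ^+ i = 0) -> w = 0.
Proof.
move=> rk w0; rewrite -[w]rVpolyK; apply/eqP; rewrite -[X in _ == X](linear0 poly_rV).
apply/eqP; congr poly_rV; apply/eqP; apply: contraT => p0.
have roots : all (root (rVpoly w)) (enum (predC1 (0 : K))).
  apply/allP => a; rewrite mem_enum inE => a0.
  rewrite /root /rVpoly horner_poly -[X in _ == X](w0 a a0).
  apply/eqP/eq_bigr => i _.
  by rewrite valK.
have := max_poly_roots p0 roots (enum_uniq _).
by rewrite -cardE cardC1 -subn1 ltnNge (leq_trans (size_poly _ _)).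
Qed.

(** Euclidean division of the exponent [e] of [u] by [k]: on [Z'], [u^e] equals
    [t_j^(k (e %/ k)) u^(e %% k)]. The bound [minn k d.+1] forces [i <= d], so [d - i] is a genuine
    degree and not a truncated one. *)
Lemma reduce_monomial d (x : 'X_{1..m.+1}) : mdeg x = d ->
  exists g : 'I_(minn k d.+1) -> {mpoly K[m]},
    (forall i, g i \is (d - i).-homog) /\
    vanishes_on Z' ('X_[x] - \sum_i mwiden (g i) * u ^+ i).
Proof.
move=> mdegx; have := mdeg_mnmrestrict x; rewrite mdegx.
set e := x ord_max; set y := mnmrestrict x => degy.
have k_gt0 : (0 < k)%N by rewrite subn_gt0 card_finNzRing_gt1.
have e_lt : (e %% k < minn k d.+1)%N.
  by rewrite leq_min ltn_pmod //= ltnS (leq_trans (leq_mod _ _)) // degy leq_addl.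
pose i0 := Ordinal e_lt; pose g0 : {mpoly K[m]} := 'X_[y] * 'X_j ^+ (k * (e %/ k)).
exists (fun i => if i == i0 then g0 else 0); split=> [i|].
  case: eqP => [->|_]; last exact: rpred0.
  rewrite (_ : (d - i0)%N = (mdeg y + 1 * (k * (e %/ k)))%N).
    by rewrite dhomogM ?dhomogMn ?dhomogXU // dhomogX.
  rewrite -[nat_of_ord i0]/(e %% k)%N mul1n degy [in LHS](divn_eq e k).
  by rewrite modnMDl modn_mod addnA addnK mulnC.
rewrite (bigD1 i0) //= eqxx big1 ?addr0 => [|i /negPf->]; last by rewrite mwiden0 mul0r.
rewrite mpolyX_mnmrestrict -/e -/y => P PZ' v vP.
have := vanish_pow PZ' vP; rewrite mevalB !rmorphXn /= => /eqP.
rewrite subr_eq0 => /eqP kpow; rewrite mevalB !mevalM mwidenM !rmorphXn /= mevalM.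
by rewrite rmorphXn /= exprM kpow -exprM -mulrA -exprD mulnC -divn_eq subrr.
Qed.

Lemma reduce_form d (p : {mpoly K[m.+1]}) : p \is d.-homog ->
  exists g : 'I_(minn k d.+1) -> {mpoly K[m]},
    (forall i, g i \is (d - i).-homog) /\
    vanishes_on Z' (p - \sum_i mwiden (g i) * u ^+ i).
Proof.
move=> /dhomogP p_hom; rewrite [p]mpolyE big_seq.
elim/big_rec: _ => [|x q /p_hom mdegx [g [g_hom gq]]].
  exists (fun=> 0); split=> [i|P _ v _]; first exact: rpred0.
  by rewrite big1 ?subr0 ?meval0 // => i _; rewrite mwiden0 mul0r.
have [h [h_hom hx]] := reduce_monomial mdegx.
exists (fun i => p@_x *: h i + g i); split=> [i|P PZ' v vP].
  exact: dhomog_closed.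
transitivity (p@_x * ('X_[x] - \sum_i mwiden (h i) * u ^+ i).@[v 0]
   + (q - \sum_i mwiden (g i) * u ^+ i).@[v 0]).
  rewrite -mevalZ -mevalD; congr meval.
  rewrite scalerBr addrACA -opprD scaler_sumr -big_split; congr (_ - _).
  by apply: eq_bigr => i _; rewrite mwidenD mwidenZ mulrDl scalerAl.
by rewrite (hx P) // (gq P) // mulr0 addr0.
Qed.

Lemma reduced_form_dhomog d (g : 'I_(minn k d.+1) -> {mpoly K[m]}) :
    (forall i, g i \is (d - i).-homog) ->
  \sum_i mwiden (g i) * u ^+ i \is d.-homog.
Proof.
move=> g_hom; apply: rpred_sum => i _.
have id : (i <= d)%N by have := ltn_ord i; rewrite leq_min => /andP[].
have := dhomogM (mwiden_dhomog (g_hom i)) (dhomogMn i (dhomogXU K ord_max)).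
by rewrite mul1n subnK.
Qed.

(** At [(v, a)] the form becomes a polynomial in [a] with coefficients [g_i(v)]; it has fewer than
    [k + 1] coefficients and vanishes for every nonzero [a]. *)
Lemma reduced_form_eq0 d (g : 'I_(minn k d.+1) -> {mpoly K[m]}) :
    (forall i, g i \is (d - i).-homog) ->
    vanishes_on Z' (\sum_i mwiden (g i) * u ^+ i) ->
  forall i, vanishes_on Z (g i).
Proof.
move=> g_hom gZ' i P PZ v vP.
have sum_hom := reduced_form_dhomog g_hom.
have /rowP/(_ i) : \row_l (g l).@[v 0] = 0.
  apply: nonzero_roots_eq0 => [|a a0]; first exact: geq_minl.
  rewrite -[RHS](vanish_append sum_hom gZ' PZ vP a0) raddf_sum /=.
  apply: eq_bigr => l _.
  by rewrite mevalM rmorphXn /= mevalXU meval_mwiden_append append_max mxE.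
by rewrite !mxE.
Qed.

(** Bases of the quotients for [Z] in the degrees [d - i], multiplied by [u^i], together form a
    basis of the quotient for [Z'] in degree [d]. *)
Lemma hilbert_fun_cone d :
  hilbert_fun (vanishing_ideal Z') d =
    (\sum_(i < minn k d.+1) hilbert_fun (vanishing_ideal Z) (d - i))%N.
Proof.
have /choice[r rP] := hilbert_basis_exists Z.
pose b e := projT1 (cid (rP e)).
have bB e : quot_basis (fun p : {mpoly K[m]} => p \is e.-homog)
    (vanishing_ideal Z) (b e) := projT2 (cid (rP e)).
have b_hom e : forall l, b e l \is e.-homog by case: (bB e).
have hilbE e : hilbert_fun (vanishing_ideal Z) e = r e.
  exact: (hilbert_fun_basis (bB e)).
under eq_bigr do rewrite hilbE.
pose I := {i : 'I_(minn k d.+1) & 'I_(r (d - i)%N)}.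
have <- : #|{: I}| = (\sum_(i < minn k d.+1) r (d - i))%N.
  rewrite card_tagged sumnE big_map big_enum /=.
  by apply: eq_bigr => i _; rewrite card_ord.
(* The coefficient of [u^i] in the combination of the [beta x] with coefficients [c]. *)
pose slice (c : I -> K) (i : 'I_(minn k d.+1)) :=
  \sum_(l < r (d - i)%N) c (existT _ i l) *: b (d - i)%N l.
have slice_hom c i : slice c i \is (d - i).-homog.
  by apply: rpred_sum => l _; rewrite rpredZ.
pose beta (x : I) := mwiden (b (d - tag x)%N (tagged x)) * u ^+ tag x.
have sliceE c : \sum_x c x *: beta x = \sum_i mwiden (slice c i) * u ^+ i.
  transitivity (\sum_(i < minn k d.+1) \sum_(l < r (d - i)%N)
      c (existT _ i l) *: (mwiden (b (d - i)%N l) * u ^+ i)).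
    rewrite sig_big_dep /=; by apply: eq_bigr; case.
  apply: eq_bigr => i _; rewrite (big_morph _ (@mwidenD m K) (@mwiden0 m K)).
  rewrite mulr_suml; apply: eq_bigr => l _.
  by rewrite mwidenZ scalerAl.
have b_free e (c : 'I_(r e) -> K) :
  vanishes_on Z (\sum_l c l *: b e l) -> forall l, c l = 0.
  move=> cZ l; have [c0 [_ c0U]] := proj2 (bB e) 0 (rpred0 _).
  (* The zero row and [c] are both coordinates of the class of [0], hence equal. *)
  have [c00 c0c] : c0 = 0 /\ c0 = \row_l c l; last first.
    by have /rowP/(_ l) := c0c; rewrite c00 !mxE.
  split; apply: c0U; apply/(@vanishing_idealP K m Z e).
  - by rewrite rpredB ?rpred0 // rpred_sum // => i _; rewrite rpredZ ?b_hom.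
  - by move=> P _ v _; rewrite big1 ?subr0 ?meval0 // => i _; rewrite mxE scale0r.
  - by rewrite rpredB ?rpred0 // rpred_sum // => i _; rewrite rpredZ ?b_hom.
  - under eq_bigr do rewrite mxE.
    by move=> P PZ v vP; rewrite mevalB meval0 (cZ P) // subr0.
apply: (quot_dim_finType (@dhomog_closed K m.+1 d) (rpred0 _)
  (@vanishing_ideal_ker K m.+1 Z' d) (b := beta)).
- case=> i l.
  have id : (i <= d)%N by have := ltn_ord i; rewrite leq_min => /andP[].
  have := dhomogM (mwiden_dhomog (b_hom _ l)) (dhomogMn i (dhomogXU K ord_max)).
  by rewrite mul1n subnK.
(* Spanning: reduce [p], then expand each [g i] in the basis of degree [d - i]. *)
- move=> p p_hom; have [g [g_hom pg]] := reduce_form p_hom.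
  have gP (i : 'I_(minn k d.+1)) : {c : 'rV_(r (d - i)%N) |
      vanishes_on Z (g i - \sum_l c 0 l *: b (d - i)%N l)}.
    apply: cid; have [c [cP _]] := proj2 (bB _) _ (g_hom i); exists c.
    exact: vanishing_ideal_vanishes cP.
  pose c (x : I) := sval (gP (tag x)) 0 (tagged x).
  exists c; rewrite sliceE; apply/(@vanishing_idealP K m.+1 Z' d).
    by rewrite rpredB // reduced_form_dhomog.
  move=> P PZ' v vP; rewrite -[p](subrK (\sum_i mwiden (g i) * u ^+ i)) -addrA.
  rewrite mevalD (pg P) // add0r -sumrB raddf_sum big1 //= => i _.
  rewrite -mulrBl mevalM -mwidenB.
  by rewrite (vanish_mwiden (svalP (gP i)) PZ' vP) mul0r.
(* Independence: every slice vanishes on [Z], and each basis is independent there. *)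
- move=> c; rewrite sliceE => /vanishing_ideal_vanishes.
  move=> /(reduced_form_eq0 (slice_hom c)) c0 [i l].
  exact: (b_free _ (fun l => c (existT _ i l)) (c0 i) l).
Qed.
End ConeHilbert.

(** * The parametrized sets X and Y satisfy the assumptions on [Z] and [Z'] *)

Section ToricPoints.
Variables (K : finFieldType) (n s : nat) (f : 'I_s -> {set 'I_n}).
Implicit Types (x : 'rV[K]_n).

Lemma toric_XP P :
  reflect (exists2 x, in_torus x & val P = line (param_X f x)) (P \in toric_X K f).
Proof.
rewrite inE; apply: (iffP existsP) => [[x /andP[tx /eqP Px]]|[x tx Px]].
  by exists x.
by exists x; rewrite tx Px eqxx.
Qed.

Lemma toric_YP P :
  reflect (exists2 x, in_torus x & val P = line (param_Y f x)) (P \in toric_Y K f).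
Proof.
rewrite inE; apply: (iffP existsP) => [[x /andP[tx /eqP Px]]|[x tx Px]].
  by exists x.
by exists x; rewrite tx Px eqxx.
Qed.

Lemma param_X_neq0 x i : in_torus x -> param_X f x 0 i != 0.
Proof.
move=> /forallP tx; rewrite mxE; apply/prodf_neq0 => l _.
exact: expf_neq0.
Qed.

Lemma param_Y_lift x i : param_Y f x 0 (lift ord_max i) = param_X f x 0 i.
Proof. by rewrite !mxE liftK. Qed.

Lemma param_Y_max x : param_Y f x 0 ord_max = 1.
Proof. by rewrite mxE unlift_none. Qed.

Lemma expf_card_pred (a : K) : a != 0 -> a ^+ (#|K| - 1) = 1.
Proof.
move=> a0; apply: (mulfI a0); rewrite -exprS mulr1 -addn1 subnK ?expf_card //.
by rewrite ltnW // card_finNzRing_gt1.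
Qed.

Hypothesis s_gt0 : (0 < s)%N.
Let i0 := Ordinal s_gt0.

Lemma toric_X_line x : in_torus x ->
  exists2 P, P \in toric_X K f & val P = line (param_X f x).
Proof.
move=> tx; have [|P Px] := @proj_line K s (param_X f x).
  by apply/rV0Pn; exists i0; apply: param_X_neq0.
by exists P => //; apply/toric_XP; exists x.
Qed.

Lemma toric_X_gt0 : (0 < #|toric_X K f|)%N.
Proof.
have [|P PX _] := @toric_X_line (const_mx 1).
  by apply/forallP => j; rewrite mxE oner_neq0.
by apply/card_gt0P; exists P.
Qed.

(** Dropping the last coordinate of a representative of a point of Y leaves a representative of a
    point of X. *)
Lemma mwiden_vanishes_toric_Y g :
  vanishes_on (toric_X K f) g -> vanishes_on (toric_Y K f) (mwiden g).
Proof.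
move=> gX P /toric_YP[x tx ->] w /lineP[c c0 ->].
have [Q QX Qx] := toric_X_line tx.
have /(gX Q QX) : c *: param_X f x \in val Q by rewrite Qx; apply/lineP; exists c.
move=> <-; rewrite meval_mwiden; apply: meval_eq => i.
by rewrite [LHS]mxE [RHS]mxE param_Y_lift.
Qed.

Lemma pow_vanishes_toric_Y : vanishes_on (toric_Y K f)
  (mwiden 'X_i0 ^+ (#|K| - 1) - 'X_ord_max ^+ (#|K| - 1)).
Proof.
move=> P /toric_YP[x tx ->] w /lineP[c c0 ->].
rewrite mevalB !rmorphXn /= meval_mwiden !mevalXU ![fun_of_matrix (c *: _) _ _]mxE.
rewrite param_Y_lift param_Y_max mulr1.
by rewrite !expf_card_pred ?subrr // mulf_neq0 // param_X_neq0.
Qed.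

Hypothesis ideal_Y : forall p : {mpoly K[s.+1]},
  vanishing_ideal (toric_Y K f) p ->
  ideal_add (ideal_widen (vanishing_ideal (toric_X K f)))
    (ideal_gen (eq ('X_ord0 ^+ (#|K| - 1) - 'X_ord_max ^+ (#|K| - 1)))) p.

(** The hypothesis on [I(Y)] enters here, as [(v, a)] is not known beforehand to represent a point
    of Y. Elements of [I(X)] ignore the last coordinate, and the binomial takes the value [1 - 1]
    since [v_1] and [a] are nonzero. *)
Lemma vanishes_append d p : p \is d.-homog -> vanishes_on (toric_Y K f) p ->
  forall P, P \in toric_X K f -> forall v, v \in val P -> forall a, a != 0 ->
  p.@[append v a 0] = 0.
Proof.
move=> p_hom /(vanishing_idealP _ p_hom)/ideal_Y.
move=> [_ [_ [[k1 [a1 [g1 [g1I ->]]]] [k2 [a2 [g2 [g2E ->]]]] ->]]] P PX v vP a a0.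
have [x tx Px] := toric_XP _ PX; have := vP; rewrite Px => /lineP[c c0 defv].
rewrite mevalD !raddf_sum /= !big1 ?addr0 // => i _; rewrite mevalM.
  rewrite -(g2E i) mevalB !rmorphXn /= !mevalXU append_max.
  have -> : ord0 = lift ord_max i0 by exact/val_inj/esym/lift_max.
  rewrite append_lift !expf_card_pred ?subrr ?mulr0 //.
  by rewrite defv mxE mulf_neq0 // param_X_neq0.
have [g gI ->] := g1I i; rewrite meval_mwiden_append.
by rewrite (vanishing_ideal_vanishes gI PX vP) mulr0.
Qed.

Lemma hilbert_fun_toric_Y d :
  hilbert_fun (vanishing_ideal (toric_Y K f)) d =
    (\sum_(i < minn (#|K| - 1) d.+1)
       hilbert_fun (vanishing_ideal (toric_X K f)) (d - i))%N.
Proof.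
exact: (hilbert_fun_cone mwiden_vanishes_toric_Y pow_vanishes_toric_Y vanishes_append).
Qed.

End ToricPoints.

(** * The regularity as a least index, and the geometric polynomial *)

Lemma regularity_eq (K : fieldType) m (I : {mpoly K[m]} -> Prop) N p :
  is_reg_index I N p -> (forall p', is_reg_index I N p' -> (p <= p')%N) ->
  regularity I N = p.
Proof.
move=> Ip pmin; apply: xget_unique => [//|p' [Ip' p'min]].
by apply/eqP; rewrite eqn_leq pmin // p'min.
Qed.

(** The given index [p] rules out the default value of [regularity]; a least index then exists by
    well-ordering. *)
Lemma regularity_spec (K : fieldType) m (I : {mpoly K[m]} -> Prop) N p :
  is_reg_index I N p -> is_reg_index I N (regularity I N) /\
  forall p', is_reg_index I N p' -> (regularity I N <= p')%N.
Proof.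
move=> Ip; have exP : exists p, `[< is_reg_index I N p >] by exists p; apply/asboolP.
case: (ex_minnP exP) => r /asboolP Ir rmin.
have rmin' p' : is_reg_index I N p' -> (r <= p')%N by move=> /asboolP/rmin.
by rewrite (regularity_eq Ir rmin').
Qed.

Lemma coef_geometric k e : (\sum_(0 <= i < k) 'X^i : {poly int})`_e = (e < k)%N.
Proof.
rewrite coef_sum; under eq_bigr do rewrite coefXn.
rewrite big_mkord; case: ltnP => [ek|ke].
  rewrite (bigD1 (Ordinal ek)) //= eqxx big1 ?addr0 // => i /negPf.
  by rewrite -val_eqE /= eq_sym => ->.
by rewrite big1 // => i _; rewrite gtn_eqF // (leq_trans (ltn_ord i)).
Qed.

(** * Series and regularity when one Hilbert function is a sum of [k] shifts of another *)

Section ConvolvedHilbert.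
Variables (K : fieldType) (m m' k N : nat).
Variables (I : {mpoly K[m]} -> Prop) (J : {mpoly K[m']} -> Prop).
Hypothesis k_gt0 : (0 < k)%N.
Hypothesis hilbertJ : forall d,
  hilbert_fun J d = (\sum_(i < minn k d.+1) hilbert_fun I (d - i))%N.

Lemma hilbert_series_convolved :
  hilbert_series J =1
    fps_mul (hilbert_series I) (fps_of_poly (\sum_(0 <= i < k) 'X^i)).
Proof.
move=> d; rewrite /hilbert_series /fps_mul /fps_of_poly hilbertJ.
rewrite (big_morph Posz PoszD (erefl _)).
(* The sum is extended to all [i <= d] under a condition, then reversed: the Cauchy product puts the
   index [i], not [d - i], on the first factor. *)
rewrite (big_ord_widen_cond d.+1 xpredT (fun i => (hilbert_fun I (d - i))%:Z)) ?geq_minr //.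
rewrite (reindex_inj rev_ord_inj) big_mkcond /=.
apply: eq_bigr => i _; rewrite coef_geometric leq_min subSS.
rewrite subKn ?ltnS ?leq_subr ?andbT; last by rewrite -ltnS.
by case: ltnP; rewrite ?mulr1 ?mulr0.
Qed.

(** From degree [k - 1 + p] on, all [k] summands are present and have degree at least [p]. *)
Lemma is_reg_index_convolved p :
  is_reg_index I N p -> is_reg_index J (k * N) (k.-1 + p).
Proof.
move=> Ip d pd; rewrite hilbertJ (minn_idPl _); last by lia.
rewrite (eq_bigr (fun=> N)) ?sum_nat_const ?card_ord // => i _.
by apply: Ip; have := ltn_ord i; lia.
Qed.

Hypothesis N_gt0 : (0 < N)%N.
Hypothesis hilbertI_le : forall d, (hilbert_fun I d <= N)%N.

(** No summand exceeds [N], so the sum falls short of [k N] as soon as one summand is missing or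
    smaller than [N]; this happens in degree [k - 2 + r]. *)
Lemma regularity_convolved p : is_reg_index I N p ->
  regularity J (k * N) = (k.-1 + regularity I N)%N.
Proof.
move=> /regularity_spec[]; set r := regularity I N => Ir rmin.
apply: regularity_eq => [|p' Jp']; first exact: is_reg_index_convolved.
rewrite leqNgt; apply/negP => p'lt.
have sum_lt d : (p' <= d)%N ->
  ~ (\sum_(i < minn k d.+1) hilbert_fun I (d - i) < k * N)%N.
  by move=> p'd; rewrite -hilbertJ Jp' // ltnn.
have leN l d : (\sum_(i < l) hilbert_fun I (d - i) <= l * N)%N.
  by rewrite -[X in (X * N)%N]card_ord -sum_nat_const leq_sum.
(* If [r = 0], the sum in degree [k - 2] has only [k - 1] terms. *)
have [r0|r_gt0] := posnP r.
  apply: (sum_lt k.-2); [lia|].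
  rewrite (minn_idPr _); last by lia.
  apply: leq_ltn_trans (leN _ _) _; rewrite ltn_pmul2r //; lia.
(* If [r > 0], the last summand is the value of [hilbert_fun I] at [r - 1], which differs from [N]
   by minimality of [r]. *)
apply: (sum_lt (k.-1 + r.-1)%N); [lia|].
rewrite (minn_idPl _); last by lia.
have -> : (k * N = k.-1 * N + N)%N by rewrite addnC -mulSn prednK.
rewrite -[in X in (X < _)%N](prednK k_gt0) big_ord_recr /= -addnS.
rewrite leq_add ?leN // addKn ltn_neqAle hilbertI_le andbT.
apply/eqP => rE; suff /rmin : is_reg_index I N r.-1 by lia.
move=> d; rewrite leq_eqVlt => /predU1P[<- //|rd].
by apply: Ir; lia.
Qed.

End ConvolvedHilbert.

Theorem proposition2p12 (K : finFieldType) (hq : #|K| <> 2%N)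
    (n s : nat) (hs : (0 < s)%N)
    (C : {set {set 'I_n}}) (hC : is_clutter C)
    (f : 'I_s -> {set 'I_n}) (f_inj : injective f) (f_edges : f @: 'I_s = C)
    (IX := vanishing_ideal (toric_X K f))
    (IY := vanishing_ideal (toric_Y K f))
    (hI : forall p : {mpoly K[s.+1]},
        IY p <->
        ideal_add (ideal_widen IX)
          (ideal_gen (eq ('X_ord0 ^+ (#|K| - 1) - 'X_ord_max ^+ (#|K| - 1)))) p) :
  [/\ hilbert_series IY =1
        fps_mul (hilbert_series IX)
          (fps_of_poly (\sum_(0 <= i < (#|K| - 2).+1) 'X^i)),
      #|toric_Y K f| = ((#|K| - 1) * #|toric_X K f|)%N
    & regularity IY #|toric_Y K f| =
        ((#|K| - 2) + regularity IX #|toric_X K f|)%N].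
Proof.
have K_gt1 : (1 < #|K|)%N := card_finNzRing_gt1 K.
have hilbertY d := hilbert_fun_toric_Y hs (fun p => proj1 (hI p)) d.
have Kpred : (#|K| - 2)%N = (#|K| - 1).-1 by lia.
have k_gt0 : (0 < #|K| - 1)%N by lia.
have IX_reg : is_reg_index IX #|toric_X K f| #|toric_X K f|.
  by move=> d; apply: hilbert_fun_large.
(* Both sides are the value of the Hilbert function of Y in one degree, taken beyond both
   stabilization bounds. *)
have cardY : #|toric_Y K f| = ((#|K| - 1) * #|toric_X K f|)%N.
  have IY_reg := is_reg_index_convolved k_gt0 hilbertY IX_reg.
  rewrite -(IY_reg (maxn #|toric_Y K f| ((#|K| - 1).-1 + #|toric_X K f|)))
    ?leq_maxr //.
  by rewrite hilbert_fun_large // leq_maxl.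
split=> //.
  by rewrite Kpred prednK //; apply: hilbert_series_convolved.
rewrite cardY Kpred; apply: (regularity_convolved k_gt0 hilbertY _ _ IX_reg).
- exact: toric_X_gt0.
- exact: hilbert_fun_le.
Qed.
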